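(* Let $(V,\Omega)$ be a symplectic vector space with canonical Liouville form $\theta$, given by $\theta_z(v_z)=\frac12\Omega(z,v)$ for $z,v\in V$. Let $a\in V$, let $\psi^a:V\to\mathbb{R}$ be $\psi^a(z)=\frac14\Omega(a,z)^2$, and let $\theta^a=\theta+{\rm d}\psi^a$. Then $${\rm Aut}(V,\theta^a)=\{g\in{\rm Sp}(V,\Omega): g(a)=a\ \text{or}\ g(a)=-a\}.$$
   Context: A symplectic vector space $(V,\Omega)$ is a finite-dimensional real vector space $V$ with a nonsingular alternating bilinear form $\Omega$. Regard $V$ as a smooth manifold; for $z,v\in V$ let $v_z\in T_zV$ be the tangent vector given by $v_z\psi=\frac{\rm d}{{\rm d}t}\psi(z+tv)|_{t=0}$ for smooth $\psi:V\to\mathbb{R}$. ${\rm Sp}(V,\Omega)$ is the group of linear automorphisms $g$ of $V$ with $\Omega(gx,gy)=\Omega(x,y)$ for all $x,y\in V$. For a one-form $\alpha$ on $V$, ${\rm Aut}(V,\alpha)$ is the group of all diffeomorphisms $g:V\to V$ with $g^*\alpha=\alpha$. *)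

(* Defs.v *)
From HB Require Import structures.
From mathcomp Require Import all_boot all_order all_algebra.
From mathcomp Require Export sesquilinear.
From mathcomp Require Import all_classical all_reals topology normedtype derive.

Set Implicit Arguments.
Unset Strict Implicit.
Unset Printing Implicit Defensive.
Import Order.TTheory GRing.Theory Num.Theory.
Import numFieldNormedType.Exports.
Local Open Scope classical_set_scope.
Local Open Scope ring_scope.

(* On a finite-dimensional [E] this is C^k: the directional derivatives        *)
(* determine the differential, so its continuity (for k = 1) and its further   *)
(* regularity can be tested on each of them.                                   *)
Fixpoint Ck (R : realType) (E F : normedModType R) (k : nat) (f : E -> F) :
    Prop :=
  if k is k'.+1 then
    (forall x, differentiable f x) /\ (forall v, Ck k' (fun x => 'D_v f x))
  else continuous f.

Section Manifold.
Context {R : realType} {V : vectType R}.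
Implicit Types (g : V -> V) (z v : V).

(* The manifold structure of [V] is that of the global linear chart given by   *)
(* coordinates in a basis; it does not depend on the basis.                    *)
Definition to_chart : V -> 'rV[R]_(\dim {:V}) := passmx.rVof (vbasis {:V}).
Definition of_chart : 'rV[R]_(\dim {:V}) -> V := passmx.vecof (vbasis {:V}).
Definition in_chart g : 'rV[R]_(\dim {:V}) -> 'rV[R]_(\dim {:V}) :=
  to_chart \o g \o of_chart.

Definition smooth g : Prop := forall k, Ck k (in_chart g).

Definition diffeomorphism g : Prop :=
  smooth g /\ exists h : V -> V, [/\ cancel g h, cancel h g & smooth h].

(* The tangent vector v_z is represented by the pair (z, v): this is the w     *)
(* such that (dg)_z (v_z) = w_(g z).                                           *)
Definition tangent_map g z v : V :=
  of_chart ('d (in_chart g) (to_chart z) (to_chart v)).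

(* [alpha z v] stands for alpha_z(v_z). Linearity in [v] and smoothness in [z] *)
(* are not recorded in the type.                                               *)
Definition one_form : Type := V -> V -> R.

Definition add_form (alpha beta : one_form) : one_form :=
  fun z v => alpha z v + beta z v.

(* v_z psi, the derivative of psi(z + t v) at t = 0.                           *)
Definition exterior_derivative (psi : V -> R) : one_form :=
  fun z v => derive1 (fun t : R => psi (z + t *: v)) 0.

Definition pullback g (alpha : one_form) : one_form :=
  fun z v => alpha (g z) (tangent_map g z v).

Definition Aut (alpha : one_form) : set (V -> V) :=
  [set g | diffeomorphism g /\ pullback g alpha = alpha].

Definition symplectic_form (Omega : {biscalar V}) : Prop :=
  (forall x, Omega x x = 0) /\
  (forall x, (forall y, Omega x y = 0) -> x = 0).

Definition Sp (Omega : {biscalar V}) : set (V -> V) :=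
  [set g | [/\ linear g, bijective g &
               forall x y, Omega (g x) (g y) = Omega x y]].

Definition liouville (Omega : {biscalar V}) : one_form :=
  fun z v => 2^-1 * Omega z v.

Definition psi_ (Omega : {biscalar V}) (a : V) : V -> R :=
  fun z => 4^-1 * Omega a z ^+ 2.

Definition theta_ (Omega : {biscalar V}) (a : V) : one_form :=
  add_form (liouville Omega) (exterior_derivative (psi_ Omega a)).

End Manifold.

(* Main.v *)
From HB Require Import structures.
Require Import Defs.
From mathcomp Require Import all_boot all_order all_algebra ring.
From mathcomp Require Import all_classical all_reals topology normedtype derive.
From mathcomp Require Import sequences realfun exp.
Import Order.TTheory GRing.Theory Num.Theory numFieldNormedType.Exports.
Local Open Scope classical_set_scope.
Local Open Scope ring_scope.
Set Implicit Arguments.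
Unset Strict Implicit.
Unset Printing Implicit Defensive.

(** Write w for the symplectic form and T for the linear map
    T z = z + w(a,z) a; it is invertible, and N = T - 1 satisfies N^2 = 0
    because w(a,a) = 0.  Differentiating psi^a gives
    theta^a_z(v) = w(Tz,v)/2 ([theta_shear]), so T is, up to the constant 2,
    the vector field dual to theta^a with respect to w.

    Let g preserve theta^a.  Since the exterior derivative of theta^a is w,
    the map g preserves w; concretely, one differentiates
    w(T g(z), dg_z v) = w(Tz, v) in the direction u and antisymmetrises in u
    and v, the second derivatives of g cancelling by symmetry
    ([derive_comm_rV], [invariant_symplectic]).  A map preserving w and theta^a
    preserves the dual vector field, dg_z(Tz) = T g(z)
    ([invariant_derivative_shear]), hence commutes with its flow
    phi_t(z) = e^t (z + t Nz) ([invariant_flow]).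

    This forces g to be linear.  Differentiating g phi_t = phi_t g at z gives
    dg_(phi_t z) (u + t Nu) = dg_z u + t N dg_z u ([derivative_flow]), and
    phi_t z tends to 0 as t tends to -oo.  For u = a, where Nu = 0, the
    left-hand side converges to dg_0 a; the right-hand side is affine in t, so
    it is constant.  Hence dg_. a is constant along the flow line of z, and for
    arbitrary u the equation shows that dg_(phi_t z) u is itself affine in t
    and convergent, so that dg_z u = dg_0 u
    ([invariant_derivative_cst]).  As g(0) = 0, g is the linear map dg_0.

    For a linear symplectic g, preserving theta^a amounts to
    w(a,gz) w(a,gv) = w(a,z) w(a,v) for all z, v, that is, to the linear
    functional w(a,g.) = w(g^-1 a, .) having the same square as w(a,.); this
    means g^-1 a = a or g^-1 a = -a ([Sp_fix_up_to_sign]).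

    The calculus is done on row vectors, through the chart that defines
    smoothness on V. *)

(** * Calculus on row vectors *)

Lemma linear_continuous_rV (R : realType) (n : nat) (W : normedModType R)
    (f : {linear 'rV[R]_n -> W}) : continuous f.
Proof.
have -> : f = (fun x => \sum_i x 0 i *: f 'e_i) :> ('rV_n -> W).
  apply/funext => x; rewrite {1}[x]row_sum_delta linear_sum.
  by apply: eq_bigr => i _; rewrite linearZ.
apply: continuous_big => [|i _ x]; first exact: add_continuous.
exact: (@cvgZr_tmp R W 'rV[R]_n (nbhs x) _ (fun M => M 0 i) _ (f 'e_i)
  (@coord_continuous R 1 n 0 i x)).
Qed.

Lemma is_derive_linear (R : realType) (n : nat) (U W : normedModType R)
    (f : 'rV[R]_n -> W) (F : U -> 'rV[R]_n) (x v : U) (dF : 'rV[R]_n) :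
  linear f -> is_derive x v F dF -> is_derive x v (fun y => f (F y)) (f dF).
Proof.
move=> lf [dv <-].
pose g : {linear 'rV[R]_n -> W} :=
  HB.pack f (GRing.isLinear.Build _ _ _ _ f lf).
rewrite -[f]/(g : _ -> _).
have cv : (fun h : R => h^-1 *: (g (F (h *: v + x)) - g (F x))) @ 0^'
    --> g ('D_v F x).
  have -> : (fun h : R => h^-1 *: (g (F (h *: v + x)) - g (F x))) =
      g \o (fun h => h^-1 *: (F (h *: v + x) - F x)).
    by apply/funext => h; rewrite -linearB -linearZ_LR.
  apply: cvg_comp; first exact: dv.
  exact: linear_continuous_rV.
by split; [apply/cvg_ex; eexists; exact: cv | exact: cvg_lim cv].
Qed.

(** A derivative in the direction u is an ordinary derivative along the line, so
    the one-variable mean value theorem applies to directional derivatives. *)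
Lemma is_derive_line (R : realType) (U W : normedModType R) (f : U -> W)
    (x u : U) (r : R) :
  derivable f (x + r *: u) u ->
  is_derive r 1 (fun s : R => f (x + s *: u)) ('D_u f (x + r *: u)).
Proof.
move=> df.
have cv : (fun h : R => h^-1 *: (f (x + (h *: 1 + r) *: u) - f (x + r *: u)))
    @ 0^' --> 'D_u f (x + r *: u).
  have -> : (fun h : R => h^-1 *: (f (x + (h *: 1 + r) *: u) - f (x + r *: u)))
     = (fun h : R => h^-1 *: (f (h *: u + (x + r *: u)) - f (x + r *: u))).
    apply/funext => h; congr (_ *: (f _ - _)).
    by rewrite scalerDl [_%:A]mulr1 addrCA.
  exact: df.
by split; [apply/cvg_ex; eexists; exact: cv | exact: cvg_lim cv].
Qed.

Lemma is_derive_curve (R : realType) (U W : normedModType R) (f : U -> W)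
    (c : R -> U) (t : R) (dc : U) :
  differentiable f (c t) -> is_derive t 1 c dc ->
  is_derive t 1 (fun s => f (c s)) ('D_dc f (c t)).
Proof.
move=> df [dvc vc].
have dc1 : differentiable c t by apply/derivable1_diffP.
have dfc : differentiable (f \o c) t by exact: differentiable_comp.
split; first exact/derivable1_diffP.
have vc' : 'd c t 1 = dc by rewrite -vc deriveE.
by rewrite [LHS]deriveE// diff_comp//= vc' deriveE.
Qed.

Lemma is_derive_scalel (R : realType) (W : normedModType R) (k : R -> R)
    (t dk : R) (c : W) :
  is_derive t 1 k dk -> is_derive t 1 (fun s => k s *: c) (dk *: c).
Proof.
move=> Dk; have dl : differentiable ( *:%R^~ c : R -> W) (k t) by [].
apply: is_derive_eq; first exact: is_derive_curve dl Dk.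
by rewrite deriveE// diff_val.
Qed.

Lemma is_derive_biscalar (R : realType) (n : nat) (U : normedModType R)
    (w : {biscalar 'rV[R]_n}) (F H : U -> 'rV[R]_n) (x v : U)
    (dF dH : 'rV[R]_n) :
  is_derive x v F dF -> is_derive x v H dH ->
  is_derive x v (fun y => w (F y) (H y)) (w (F x) dH + w dF (H x)).
Proof.
move=> DF DH.
have wE b c : w b c = \sum_i w b 'e_i * c 0 i.
  rewrite {1}[c]row_sum_delta linear_sumr; apply: eq_bigr => i _.
  by rewrite linearZr mulrC.
have -> : (fun y => w (F y) (H y)) = \sum_i (fun y => w (F y) 'e_i * H y 0 i).
  by apply/funext => y; rewrite wE fct_sumE.
apply: is_derive_eq; first apply: is_derive_sum => i.
  apply: is_deriveM.
    apply: (@is_derive_linear _ _ _ _ (w^~ 'e_i)) DF.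
    by move=> k b c; exact: linearPl.
  apply: (@is_derive_linear _ _ _ _ (fun M => M 0 i)) DH.
  by move=> k b c; rewrite !mxE.
rewrite !wE -big_split; apply: eq_bigr => i _ /=.
by rewrite [w dF _ *  _]mulrC.
Qed.

(** An affine function of -t with a limit at +oo is constant: divided by t, the
    difference to its value at 0 tends both to y and to 0. *)
Lemma affine_cvg (R : realType) (W : normedModType R) (f : R -> W)
    (x y l : W) :
  (forall t, f t = x + (- t) *: y) -> f t @[t --> +oo] --> l -> y = 0 /\ x = l.
Proof.
move=> fE fl.
have y0 : y = 0.
  have iv : t^-1 @[t --> +oo] --> (0 : R).
    apply/(gtr0_cvgV0 (f := id)); last exact: cvg_id.
    exact: nbhs_pinfty_gt.
  have c1 : t^-1 *: (x - f t) @[t --> +oo] --> 0 *: (x - l).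
    by apply: cvgZ => //; apply: cvgB => //; exact: cvg_cst.
  have c2 : t^-1 *: (x - f t) @[t --> +oo] --> y.
    apply: cvg_near_cst; near=> t.
    have t0 : t != 0 by rewrite gt_eqF//; near: t; exact: nbhs_pinfty_gt.
    by rewrite fE opprD addrA subrr add0r scaleNr opprK scalerA mulVf// scale1r.
  by rewrite (cvg_unique (@norm_hausdorff _ _) c2 c1) scale0r.
split=> //; apply: (cvg_unique (@norm_hausdorff _ _)) fl.
by apply: cvg_near_cst; near=> t; rewrite fE y0 scaler0 addr0.
Unshelve. all: by end_near. Qed.

(** * Symmetry of second derivatives *)

Section Schwarz.
Variables (R : realType) (U : normedModType R).

(** Two applications of the mean value theorem, first along u to the increment
    of f in the direction s v, then along v to the u-derivative. The left-hand
    side is symmetric in u and v, which is what makes the mixed derivatives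
    agree in the limit. *)
Lemma second_difference (f : U -> R) (x u v : U) (s : R) : 0 < s ->
  (forall y, differentiable f y) ->
  (forall y, differentiable (fun z => 'D_u f z) y) ->
  exists p : R * R, [/\ 0 < p.1 < s, 0 < p.2 < s &
    f (x + s *: u + s *: v) - f (x + s *: u) - f (x + s *: v) + f x =
    'D_v (fun z => 'D_u f z) (x + p.1 *: u + p.2 *: v) * s ^+ 2].
Proof.
move=> s0 df ddf.
pose h (r : R) := f (x + s *: v + r *: u) - f (x + r *: u).
pose dh (r : R) := 'D_u f (x + s *: v + r *: u) - 'D_u f (x + r *: u).
have hD (r : R) : is_derive r 1 h (dh r).
  by apply: is_deriveB; apply: is_derive_line; exact: diff_derivable.
have [|c cs hc] := @MVT R h dh 0 s s0 (fun r _ => hD r).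
  apply: derivable_within_continuous => r _; by case: (hD r).
pose k (r : R) := 'D_u f (x + c *: u + r *: v).
have kD (r : R) :
    is_derive r 1 k ('D_v (fun z => 'D_u f z) (x + c *: u + r *: v)).
  exact/is_derive_line/diff_derivable.
have [|e es ke] := @MVT R k _ 0 s s0 (fun r _ => kD r).
  apply: derivable_within_continuous => r _; by case: (kD r).
exists (c, e); split => /=; rewrite -?in_itv//.
move: hc ke; rewrite /k /h /dh !subr0 !scale0r !addr0 => hc ke.
rewrite expr2 mulrA -ke [x + c *: u + _]addrAC -hc [x + s *: v + _]addrAC.
ring.
Qed.

Lemma continuous_plane (k : U -> R) (x u v : U) (e : R) :
  {for x, continuous k} -> 0 < e ->
  exists2 d : R, 0 < d & forall p q : R, 0 < p < d -> 0 < q < d ->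
    `|k x - k (x + p *: u + q *: v)| < e.
Proof.
move=> /cvgrPdist_lt kc e0.
have /nbhs_ballP[r /= r0 kr] := kc _ e0.
have m0 : 0 < `|u| + `|v| + 1 by rewrite ltr_wpDl// addr_ge0.
exists (r / (`|u| + `|v| + 1)); first by rewrite divr_gt0.
move=> p q /andP[p0 pd] /andP[q0 qd]; apply: kr.
rewrite -ball_normE /= -addrA opprD addNKr normrN.
apply: le_lt_trans (ler_normD _ _) _; rewrite !normrZ !gtr0_norm//.
move: pd qd; rewrite !ltr_pdivlMr// => pd qd.
have [pq|qp] := leP p q.
  apply: le_lt_trans qd; rewrite !mulrDr -addrA lerD ?ler_wpM2r// lerDl mulr1.
  exact: ltW.
apply: le_lt_trans pd; rewrite !mulrDr -addrA lerD//.
by rewrite -[leLHS]addr0 lerD ?ler_wpM2r ?mulr1 // ltW.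
Qed.

(** Schwarz's theorem: for every small s the same second difference is s^2 times
    a value of either mixed derivative near x. *)
Lemma derive_comm (f : U -> R) (x u v : U) :
  (forall y, differentiable f y) ->
  (forall y, differentiable (fun z => 'D_u f z) y) ->
  (forall y, differentiable (fun z => 'D_v f z) y) ->
  {for x, continuous (fun y => 'D_v (fun z => 'D_u f z) y)} ->
  {for x, continuous (fun y => 'D_u (fun z => 'D_v f z) y)} ->
  'D_v (fun z => 'D_u f z) x = 'D_u (fun z => 'D_v f z) x.
Proof.
move=> df du dv cu cv; apply/eqP; rewrite -subr_eq0 -normr_le0.
apply/ler_addgt0Pr => e e0; rewrite add0r.
have e20 : 0 < e / 2 by rewrite divr_gt0.
have [d d0 nu] := continuous_plane u v cu e20.
have [d' d'0 nv] := continuous_plane v u cv e20.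
pose s := Num.min d d' / 2.
have m0 : 0 < Num.min d d' by rewrite lt_min d0.
have s0 : 0 < s by rewrite divr_gt0.
have [sd sd'] : s < d /\ s < d'.
  by apply/andP; rewrite -lt_min ltr_pdivrMr// ltr_pMr// ltr1n.
have [[p q] [/= /andP[p0 ps] /andP[q0 qs] E1]] :=
  second_difference x v s0 df du.
have [[p' q'] [/= /andP[p'0 p's] /andP[q'0 q's] E2]] :=
  second_difference x u s0 df dv.
have h1 := nu p q; have h2 := nv p' q'.
rewrite p0 q0 (lt_trans ps)// (lt_trans qs)// in h1.
rewrite p'0 q'0 (lt_trans p's)// (lt_trans q's)// in h2.
have tri (A B C D : R) : `|A - C| < e / 2 -> `|B - D| < e / 2 -> C = D ->
    `|A - B| <= e.
  move=> AC BD CD; rewrite -CD distrC in BD; rewrite [e]splitr ltW//.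
  exact: le_lt_trans (ler_distD _ _ _) (ltrD AC BD).
apply: tri (h1 isT isT) (h2 isT isT) _.
apply: (mulIf (_ : s ^+ 2 != 0)); first by rewrite expf_neq0// gt_eqF.
apply: (etrans (esym E1)); apply: etrans E2.
by rewrite (addrAC x (s *: v)); congr (_ + _); exact: addrAC.
Qed.
End Schwarz.

Lemma derive_comm_rV (R : realType) (U : normedModType R) (n : nat)
    (G : U -> 'rV[R]_n) (x u v : U) : Ck 2 G ->
  'D_v (fun z => 'D_u G z) x = 'D_u (fun z => 'D_v G z) x.
Proof.
move=> [dG d2G].
have d1 a y : differentiable (fun z => 'D_a G z) y by case: (d2G a).
have coordD (F : U -> 'rV[R]_n) i y a : differentiable F y ->
    'D_a (fun z => F z 0 i) y = 'D_a F y 0 i.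
  by move=> dF; rewrite derive_mx ?mxE//; exact: diff_derivable.
have coord_diff (F : U -> 'rV[R]_n) i y : differentiable F y ->
    differentiable (fun z => F z 0 i) y.
  move=> dF; apply: (@differentiable_comp _ _ _ _ F (fun M => M 0 i : R)) => //.
  exact: differentiable_coord.
apply/rowP => i.
have D1 a : (fun z => 'D_a (fun y => G y 0 i) z) = (fun z => 'D_a G z 0 i).
  by apply/funext => z; rewrite coordD.
have D2 a b : (fun z => 'D_b (fun y => 'D_a (fun y => G y 0 i) y) z) =
    (fun z => 'D_b (fun y => 'D_a G y) z 0 i).
  by apply/funext => z; rewrite D1 coordD.
have cD2 a b : {for x, continuous
    (fun z => 'D_b (fun y => 'D_a (fun y => G y 0 i) y) z)}.
  rewrite D2; apply: (@continuous_comp _ _ _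
    (fun z => 'D_b (fun y => 'D_a G y) z) (fun M : 'rV[R]_n => M 0 i)).
    by case: (d2G a) => _ cD; exact: cD.
  exact: coord_continuous.
apply: (etrans (esym (congr1 (@^~ x) (D2 u v)))).
apply: etrans (congr1 (@^~ x) (D2 v u)).
apply: derive_comm.
- by move=> y; exact: coord_diff.
- by move=> y; rewrite D1; exact: coord_diff.
- by move=> y; rewrite D1; exact: coord_diff.
- exact: cD2.
- exact: cD2.
Qed.

(** * Symplectic linear algebra *)

Lemma linear_inj_surj (K : fieldType) (V : vectType K) (f : V -> V) :
  linear f -> injective f -> exists2 h : V -> V, cancel f h & cancel h f.
Proof.
move=> lf fI.
pose g : {linear V -> V} := HB.pack f (GRing.isLinear.Build _ _ _ _ f lf).
have kg : lker (linfun g) == 0%VS.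
  by apply/lker0P => x y; rewrite !lfunE => /fI.
exists (linfun g)^-1%VF => x.
  by have := lker0_lfunK kg x; rewrite lfunE.
by have := lker0_lfunVK kg x; rewrite lfunE.
Qed.

(** The generic bilinearity lemmas also match the product of R, which is itself
    bilinear; with the form as explicit argument, rewriting only affects the
    form. *)
Section Biscalar.
Variables (R : nzRingType) (V : lmodType R) (w : {biscalar V}).

Lemma biscalarZl k x y : w (k *: x) y = k * w x y.
Proof. exact: linearZl_LR. Qed.

Lemma biscalarZr k x y : w x (k *: y) = k * w x y.
Proof. exact: linearZr_LR. Qed.

Lemma biscalarDr x y z : w x (y + z) = w x y + w x z.
Proof. exact: linearDr. Qed.

Lemma biscalarDl x y z : w (x + y) z = w x z + w y z.
Proof. exact: linearDl. Qed.

End Biscalar.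
Arguments biscalarZl {R V} w.
Arguments biscalarZr {R V} w.
Arguments biscalarDl {R V} w.
Arguments biscalarDr {R V} w.

Section Shear.
Variables (R : realType) (V : vectType R) (w : {biscalar V}).
Hypothesis w_symp : symplectic_form w.

Lemma symplectic_anti x y : w x y = - w y x.
Proof.
have [alt _] := w_symp.
have := alt (x + y); rewrite linearDl !linearDr !alt addr0 add0r.
by move/eqP; rewrite addr_eq0 => /eqP.
Qed.

Lemma symplectic_inj x y : (forall v, w x v = w y v) -> x = y.
Proof.
move=> xy; apply/eqP; rewrite -subr_eq0; apply/eqP; apply: w_symp.2 => v.
by rewrite linearBl xy subrr.
Qed.

(** The symplectic transvection along a. As a vector field, it is 2 theta^a seen
    through the duality given by w. *)
Definition shear (a z : V) : V := z + w a z *: a.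

Lemma shear_linear a : linear (shear a).
Proof.
by move=> k x y; rewrite /shear linearPr scalerDl scalerDr !scalerA addrACA.
Qed.

Lemma shear_fix a z : w a (shear a z) = w a z.
Proof. by rewrite linearDr biscalarZr w_symp.1 mulr0 addr0. Qed.

Lemma shear_eq0 a z : shear a z = 0 -> z = 0.
Proof.
move=> S0; have := shear_fix a z; rewrite S0 linear0r => wz.
by move: S0; rewrite /shear -wz scale0r addr0.
Qed.

Lemma theta_shear a z v : theta_ w a z v = 2^-1 * w (shear a z) v.
Proof.
rewrite /theta_ /add_form /liouville /exterior_derivative /psi_.
have DA : is_derive (0 : R) 1 (fun t : R => w a (z + t *: v)) (w a v).
  have -> : (fun t : R => w a (z + t *: v)) = cst (w a z) + w a v *: id.
    apply/funext => t; rewrite linearDr biscalarZr.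
    by rewrite -[RHS]/(w a z + w a v * t) [w a v * t]mulrC.
  have D := is_deriveD (is_derive_cst (w a z) (0 : R) 1)
    (is_deriveZ (w a v) (is_derive_id (0 : R) 1)).
  by apply: (is_derive_eq D); rewrite add0r [_ *: _]mulr1.
have D := is_deriveZ (4^-1 : R) (is_deriveM DA DA).
rewrite derive1E.
have -> : (fun t : R => 4^-1 * w a (z + t *: v) ^+ 2) =
    4^-1 *: ((fun t : R => w a (z + t *: v)) * (fun t : R => w a (z + t *: v))).
  by apply/funext => t; rewrite expr2.
rewrite (@derive_val _ _ _ _ _ _ _ D) /shear linearDl biscalarZl scale0r addr0.
by rewrite /GRing.scale /=; field.
Qed.

End Shear.

(** * Maps preserving the form are linear *)

Section Core.
Variables (R : realType) (n : nat) (w : {biscalar 'rV[R]_n}) (a : 'rV[R]_n).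
Hypothesis w_symp : symplectic_form w.
Variable G : 'rV[R]_n -> 'rV[R]_n.
Hypothesis G_C2 : Ck 2 G.
Hypothesis G_inv : forall z v,
  w (shear w a (G z)) ('D_v G z) = w (shear w a z) v.

Let dG z : differentiable G z. Proof. by case: G_C2. Qed.

Let derG z v : is_derive z v G ('D_v G z).
Proof. exact/derivableP/diff_derivable. Qed.

Let DG_linear z : linear (fun v => 'D_v G z).
Proof. by move=> k x y; rewrite !deriveE// linearP. Qed.

Let DG_scale k z v : 'D_(k *: v) G z = k *: 'D_v G z.
Proof. by rewrite !deriveE// linearZ. Qed.

Let DG_add z u v : 'D_(u + v) G z = 'D_u G z + 'D_v G z.
Proof. by rewrite !deriveE// linearD. Qed.

(** The symmetric part of the bilinear form w (shear a x) y is
    w(a,x) w(a,y), so antisymmetrising leaves w. *)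
Let anti_shear x y : w (shear w a x) y - w (shear w a y) x = 2 * w x y.
Proof.
rewrite /shear !(biscalarDl w) !(biscalarZl w) (symplectic_anti w_symp y x).
ring.
Qed.

(** The preserved one-form has exterior derivative w, which is therefore
    preserved too: differentiating [G_inv] along u and antisymmetrising in u and
    v, the second derivatives of G cancel. *)
Lemma invariant_symplectic z u v : w ('D_u G z) ('D_v G z) = w u v.
Proof.
have comb (X X' Y Z p q : R) : X + Y = p -> X' + Z = q -> X = X' ->
    Y - Z = p - q.
  by move=> <- <- ->; rewrite opprD addrACA subrr add0r.
have key p q : w (shear w a (G z)) ('D_p (fun y => 'D_q G y) z) +
    w (shear w a ('D_p G z)) ('D_q G z) = w (shear w a p) q.
  have dDq : is_derive z p (fun y => 'D_q G y) ('D_p (fun y => 'D_q G y) z).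
    by apply/derivableP/diff_derivable; case: G_C2 => _ /(_ q)[].
  have dSG : is_derive z p (fun y => shear w a (G y)) (shear w a ('D_p G z)).
    exact: (is_derive_linear (@shear_linear _ _ w a)).
  have dS : is_derive z p (fun y => shear w a y) (shear w a p).
    exact: (is_derive_linear (@shear_linear _ _ w a) (is_derive_id z p)).
  have d1 := is_derive_biscalar w dSG dDq.
  have d2 := is_derive_biscalar w dS (is_derive_cst q z p).
  rewrite linear0r add0r in d2.
  rewrite -(@derive_val _ _ _ _ _ _ _ d1) -(@derive_val _ _ _ _ _ _ _ d2).
  by congr ('D_p _ z); apply/funext => y; rewrite G_inv.
apply: (@mulfI _ 2); first by rewrite pnatr_eq0.
apply: (etrans (esym (anti_shear _ _))); apply: etrans (anti_shear u v).
apply: comb (key u v) (key v u) _.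
exact: (congr1 (w _) (derive_comm_rV z v u G_C2)).
Qed.

(** Both sides have the same w-product with every vector, because the derivative
    of G at z is symplectic, hence onto. *)
Lemma invariant_derivative_shear z : 'D_(shear w a z) G z = shear w a (G z).
Proof.
have inj : injective (fun v => 'D_v G z).
  move=> x y xy; apply: (symplectic_inj w_symp) => v.
  by rewrite -(invariant_symplectic z x) xy invariant_symplectic.
have [h _ hK] := linear_inj_surj (DG_linear z) inj.
apply: (symplectic_inj w_symp) => v.
by rewrite -(hK v) invariant_symplectic G_inv.
Qed.

(** 0 is the only zero of the vector field. *)
Lemma invariant_0 : G 0 = 0.
Proof.
apply: (shear_eq0 w_symp (a := a)); rewrite -invariant_derivative_shear.
by rewrite /shear linear0r scale0r addr0 derive0.
Qed.

(** The exponential of t times the shear, in closed form because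
    z |-> w(a,z) a has square zero. *)
Definition flow (t : R) (z : 'rV[R]_n) : 'rV[R]_n :=
  expR t *: (z + t *: (w a z *: a)).

Lemma flow0 z : flow 0 z = z.
Proof. by rewrite /flow expR0 scale0r addr0 scale1r. Qed.

Lemma flow_linear t : linear (flow t).
Proof.
move=> k x y; rewrite /flow linearPr.
have -> : k *: x + y + t *: ((k * w a x + w a y) *: a) =
    k *: (x + t *: (w a x *: a)) + (y + t *: (w a y *: a)).
  by rewrite scalerDl !scalerDr !scalerA addrACA !mulrA [t * k]mulrC.
by rewrite scalerDr !scalerA [expR t * k]mulrC.
Qed.

Lemma is_derive_flow (t : R) z :
  is_derive t 1 (flow ^~ z) (shear w a (flow t z)).
Proof.
have De : is_derive t 1 (expR : R -> R) (expR t) by exact: is_derive_expR.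
have -> : (flow ^~ z) = (fun s => expR s *: z) +
    (fun s => (expR s * s) *: (w a z *: a)).
  by apply/funext => s; rewrite /flow scalerDr scalerA.
have D := is_deriveD (is_derive_scalel z De) (is_derive_scalel (w a z *: a)
   (is_deriveM De (is_derive_id t 1))).
apply: (is_derive_eq D).
rewrite /shear /flow (biscalarZr w) (biscalarDr w) !(biscalarZr w) w_symp.1.
rewrite !mulr0 addr0.
rewrite scalerDr !scalerA -addrA -scalerDl; congr (_ + _ *: _).
rewrite /GRing.scale /=; ring.
Qed.

(** The curve obtained by applying to G (flow t z) the inverse of [flow t] has
    derivative zero, since G transports the vector field to itself. *)
Lemma invariant_flow (t : R) z : G (flow t z) = flow t (G z).
Proof.
have DGc (s : R) :
    is_derive s 1 (fun s => G (flow s z)) (shear w a (G (flow s z))).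
  rewrite -invariant_derivative_shear.
  exact: is_derive_curve (dG _) (is_derive_flow _ _).
pose q s := w a (G (flow s z)).
have Dq (s : R) : is_derive s 1 q (q s).
  rewrite /q -[X in is_derive _ _ _ X](shear_fix w_symp).
  apply: (@is_derive_linear _ _ _ _ (w a)) (DGc s).
  by move=> k x y; rewrite linearPr.
(* The right-hand side is [flow (- t)] applied to G (flow t z). *)
have E : G z = expR (- t) *: (G (flow t z) - t *: (q t *: a)).
  apply/rowP => i.
  pose p s := G (flow s z) 0 i.
  have Dp (s : R) : is_derive s 1 p (p s + q s * a 0 i).
    have := @is_derive_linear _ _ _ R^o (fun M => M 0 i) _ _ _ _ _ (DGc s).
    rewrite !mxE; apply => k x y; by rewrite !mxE.
  pose f s := expR (- s) * (p s - s * (q s * a 0 i)).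
  have Df (s : R) : is_derive s 1 f 0.
    have De : is_derive s 1 (fun x : R => expR (- x)) (- expR (- s)).
      have D := @is_derive1_comp R expR -%R s _ _ (is_derive_expR (- s))
        (is_deriveNid s 1).
      apply: (is_derive_eq D).
      by rewrite mulrN1.
    have D := is_deriveM De (is_deriveB (Dp s) (is_deriveM (is_derive_id s 1)
       (is_deriveM (Dq s) (is_derive_cst (a 0 i) s 1)))).
    apply: (is_derive_eq D).
    rewrite -[(p - _) s]/(p s - s * (q s * a 0 i)).
    rewrite -[(q * cst _) s]/(q s * a 0 i) -[cst _ s]/(a 0 i).
    rewrite /GRing.scale /=; ring.
  have := is_derive_0_is_cst 0 t Df.
  rewrite /f /p /q flow0 mul0r subr0 oppr0 expR0 mul1r => ->.
  by rewrite !mxE.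
have qE : w a (G z) = expR (- t) * q t.
  by rewrite E (biscalarZr w) linearBr !(biscalarZr w) w_symp.1 !mulr0 subr0.
rewrite [RHS]/flow qE {1}E.
have -> : t *: ((expR (- t) * q t) *: a) = expR (- t) *: (t *: (q t *: a)).
  by rewrite !scalerA mulrCA mulrA.
by rewrite -scalerDr subrK scalerA expRxMexpNx_1 scale1r.
Qed.

(** The z-derivative of [invariant_flow], with the common factor e^t removed. *)
Lemma derivative_flow t z u :
  'D_(u + t *: (w a u *: a)) G (flow t z) =
  'D_u G z + t *: (w a ('D_u G z) *: a).
Proof.
have Dl : is_derive z u (fun y => G (flow t y)) (flow t ('D_u G z)).
  rewrite (_ : (fun y => _) = flow t \o G).
    exact: (is_derive_linear (flow_linear t) (derG z u)).
  by apply/funext => y; rewrite /= invariant_flow.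
have Dr : is_derive z u (fun y => G (flow t y)) ('D_(flow t u) G (flow t z)).
  have Df := is_derive_linear (flow_linear t) (is_derive_id z u).
  have dF : differentiable (flow t) z.
    pose f : {linear 'rV[R]_n -> 'rV[R]_n} :=
      HB.pack (flow t) (GRing.isLinear.Build _ _ _ _ _ (flow_linear t)).
    rewrite -[flow t]/(f : _ -> _); apply: linear_differentiable.
    exact: linear_continuous_rV.
  have dGF : differentiable (G \o flow t) z by exact: differentiable_comp.
  split; first exact: diff_derivable.
  rewrite [LHS]deriveE// diff_comp//= [RHS]deriveE//; congr ('d G _ _).
  by rewrite -deriveE//; exact: (@derive_val _ _ _ _ _ _ _ Df).
have := @derive_val _ _ _ _ _ _ _ Dr.
rewrite (@derive_val _ _ _ _ _ _ _ Dl) /flow.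
rewrite DG_scale => e; apply/esym.
by apply: (scalerI (lt0r_neq0 (expR_gt0 t))); exact: e.
Qed.

Lemma flow_cvg0 z : flow (- t) z @[t --> +oo] --> (0 : 'rV[R]_n).
Proof.
have e0 : expR (- t) @[t --> +oo] --> (0 : R) by exact: cvgr_expR.
have te0 : expR (- t) * - t @[t --> +oo] --> (0 : R).
  (* t e^(-t) <= 2 e^(-t/2), because t / 2 <= e^(t/2) *)
  have h0 : 2 * expR (- (t / 2)) @[t --> +oo] --> (0 : R).
    rewrite -[X in _ --> X](mulr0 2); apply: cvgM; first exact: cvg_cst.
    apply: (@cvg_comp _ _ _ (fun t : R => t / 2) (fun t => expR (- t)) _ +oo).
      apply: gt0_cvgMly; [by rewrite invr_gt0 | exact: cvg_id].
    exact: cvgr_expR.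
  apply/norm_cvg0P.
  apply: (squeeze_cvgr _ (cvg_cst 0) h0).
  near=> t.
  have t0 : 0 <= t by near: t; exact: nbhs_pinfty_ge.
  rewrite normr_ge0 mulrN normrN ger0_norm ?mulr_ge0 ?expR_ge0//=.
  have te : t <= 2 * expR (t / 2).
    rewrite mulrC -ler_pdivrMr//; apply: le_trans (expR_ge1Dx _).
    by rewrite lerDr.
  rewrite {1}[t]splitr opprD expRD -mulrA mulrC.
  apply: le_trans (ler_wpM2r (expR_ge0 _) (ler_wpM2l (expR_ge0 _) te)) _.
  by rewrite mulrCA [expR (- _) * _]mulrC expRxMexpNx_1 mulr1.
have -> : (fun t => flow (- t) z) =
    (fun t => expR (- t) *: z + (expR (- t) * - t) *: (w a z *: a)).
  by apply/funext => t; rewrite /flow scalerDr scalerA.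
rewrite -[X in _ --> X](addr0 0) -{1}(scale0r z) -(scale0r (w a z *: a)).
by apply: cvgD; apply: cvgZr_tmp.
Unshelve. all: by end_near. Qed.

(** Along the backward flow line of z, which ends at 0, the u-derivative of G is
    affine in t and convergent. The direction a has to be treated first: it
    provides the coefficient of t for the other directions. *)
Lemma invariant_derivative_cst z u : 'D_u G z = 'D_u G 0.
Proof.
have DGcvg v : 'D_v G (flow (- t) z) @[t --> +oo] --> 'D_v G 0.
  apply: (@cvg_comp _ _ _ (fun t => flow (- t) z) (fun y => 'D_v G y) _ _ _
    (flow_cvg0 z)).
  by case: G_C2 => _ /(_ v)[dD _]; exact: (differentiable_continuous (dD 0)).
have [Na _] : w a ('D_a G z) *: a = 0 /\ 'D_a G z = 'D_a G 0.
  apply: affine_cvg (DGcvg a) => t; rewrite -derivative_flow.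
  by rewrite w_symp.1 scale0r scaler0 addr0.
have DaE t : 'D_a G (flow t z) = 'D_a G z.
  have := derivative_flow t z a.
  by rewrite Na w_symp.1 scale0r !scaler0 !addr0.
pose y := w a ('D_u G z) *: a - w a u *: 'D_a G z.
apply: (affine_cvg (y := y) _ (DGcvg u)).2 => t.
have := derivative_flow (- t) z u; rewrite DG_add !DG_scale DaE => Du.
by rewrite /y scalerBr addrA -Du addrK.
Qed.

Lemma invariant_linear : G = (fun x => 'D_x G 0).
Proof.
apply/funext => x; apply/rowP => i.
pose f (r : R) : R := (G (0 + r *: x) - r *: 'D_x G 0) 0 i.
have Df (r : R) : is_derive r 1 f 0.
  have D1 : is_derive r 1 (fun s : R => G (0 + s *: x)) ('D_x G (0 + r *: x)).
    by apply: is_derive_line; exact: diff_derivable.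
  have D2 := is_derive_scalel ('D_x G 0) (is_derive_id r 1).
  have := @is_derive_linear _ _ _ R^o (fun M => M 0 i) _ _ _ _ _
    (is_deriveB D1 D2).
  rewrite invariant_derivative_cst scale1r subrr mxE; apply.
  by move=> k y z; rewrite !mxE.
have := is_derive_0_is_cst 1 0 Df; rewrite /f !add0r !scale1r !scale0r subr0.
by rewrite invariant_0 !mxE => /eqP; rewrite subr_eq0 => /eqP.
Qed.
End Core.

(** * Transport through the linear chart *)

Lemma Ck_cst (R : realType) (E F : normedModType R) (k : nat) (c : F) :
  Ck k (fun _ : E => c).
Proof.
elim: k c => [|k IH] c /=; first exact: cst_continuous.
split=> [x|v]; first exact: differentiable_cst.
have -> : (fun x => 'D_v (fun _ : E => c) x) = (fun _ : E => 0 : F).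
  by apply/funext => x; exact: derive_cst.
exact: IH.
Qed.

Lemma Ck_linear (R : realType) (n : nat) (F : normedModType R) (k : nat)
    (f : {linear 'rV[R]_n -> F}) : Ck k f.
Proof.
case: k => [|k]; first exact: linear_continuous_rV.
have df x : differentiable f x.
  by apply: linear_differentiable; exact: linear_continuous_rV.
split=> // v; have -> : (fun x => 'D_v f x) = (fun=> f v).
  apply/funext => x; rewrite deriveE// diff_lin//.
  exact: linear_continuous_rV.
exact: Ck_cst.
Qed.

Section Chart.
Variables (R : realType) (V : vectType R).

Lemma of_chartK : cancel (@of_chart R V) (@to_chart R V).
Proof. by apply: passmx.vecofK; exact: vbasisP. Qed.

Lemma to_chartK : cancel (@to_chart R V) (@of_chart R V).
Proof. by apply: passmx.rVofK; exact: vbasisP. Qed.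

Lemma of_chart_linear : linear (@of_chart R V).
Proof. exact: passmx.vecof_linear. Qed.

HB.instance Definition _ :=
  GRing.isLinear.Build R _ _ _ (@of_chart R V) of_chart_linear.

Lemma to_chart_linear : linear (@to_chart R V).
Proof. exact: passmx.rVof_linear. Qed.

Lemma in_chart_linear (g : V -> V) : linear g -> linear (in_chart g).
Proof.
by move=> lg k x y; rewrite /in_chart /= of_chart_linear lg to_chart_linear.
Qed.

Lemma smooth_linear (g : V -> V) : linear g -> smooth g.
Proof.
move=> /in_chart_linear lG k.
exact: (Ck_linear k (HB.pack (in_chart g) (GRing.isLinear.Build _ _ _ _ _ lG))).
Qed.

Lemma tangent_map_linear (g : V -> V) (z v : V) :
  linear g -> tangent_map g z v = g v.
Proof.
move=> /in_chart_linear lG.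
pose G : {linear 'rV[R]_(\dim {:V}) -> 'rV[R]_(\dim {:V})} :=
  HB.pack (in_chart g) (GRing.isLinear.Build _ _ _ _ _ lG).
rewrite /tangent_map -[in_chart g]/(G : _ -> _) diff_lin.
  by rewrite /G /in_chart /= !to_chartK.
exact: linear_continuous_rV.
Qed.

Variable Omega : {biscalar V}.

Definition chart_form (x y : 'rV[R]_(\dim {:V})) : R :=
  Omega (of_chart x) (of_chart y).

Lemma chart_form_linearl y : scalar (chart_form^~ y).
Proof.
move=> k u v.
by rewrite /chart_form of_chart_linear (biscalarDl Omega) (biscalarZl Omega).
Qed.

Lemma chart_form_linearr x : scalar (chart_form x).
Proof.
move=> k u v.
by rewrite /chart_form of_chart_linear (biscalarDr Omega) (biscalarZr Omega).
Qed.

HB.instance Definition _ :=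
  bilinear_isBilinear.Build R _ _ _ _ _ chart_form
    (conj chart_form_linearl chart_form_linearr).

Lemma chart_form_symplectic :
  symplectic_form Omega -> symplectic_form chart_form.
Proof.
move=> [alt nd]; split=> [x|x x0]; first exact: alt.
apply: (can_inj of_chartK); rewrite linear0.
by apply: nd => y; have := x0 (to_chart y); rewrite /= /chart_form to_chartK.
Qed.

Lemma of_chart_shear a x :
  of_chart (shear chart_form (to_chart a) x) = shear Omega a (of_chart x).
Proof.
by rewrite /shear addrC of_chart_linear addrC /= /chart_form to_chartK.
Qed.

End Chart.

(** * The automorphism group *)

Section Automorphisms.
Variables (R : realType) (V : vectType R) (Omega : {biscalar V}) (a : V).
Hypothesis Omega_symp : symplectic_form Omega.

Let half_neq0 : 2^-1 != 0 :> R.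
Proof. by rewrite invr_eq0 pnatr_eq0. Qed.

(** Linearity and invariance of the form are read off in the chart; a map
    preserving a nondegenerate form is injective, hence bijective as V has
    finite dimension. *)
Lemma Aut_theta_Sp (g : V -> V) : Aut (theta_ Omega a) g -> Sp Omega g.
Proof.
move=> [[g_smooth _] g_inv].
pose G := in_chart g.
have G_C2 : Ck 2 G := g_smooth 2%N.
have gE x : g x = of_chart (G (to_chart x)).
  by rewrite /G /in_chart /= !to_chartK.
have G_inv z v : chart_form Omega (shear (chart_form Omega) (to_chart a) (G z))
      ('D_v G z) = chart_form Omega (shear (chart_form Omega) (to_chart a) z) v.
  rewrite /chart_form !of_chart_shear.
  have := congr1 (fun alpha => alpha (of_chart z) (of_chart v)) g_inv.
  rewrite /pullback !theta_shear /tangent_map !of_chartK.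
  rewrite gE of_chartK deriveE; last by case: G_C2.
  by move/(mulfI half_neq0).
have cf_symp := chart_form_symplectic Omega_symp.
have GE := invariant_linear cf_symp G_C2 G_inv.
have G_linear : linear G.
  by move=> k x y; rewrite GE !deriveE ?linearP//; case: G_C2.
have g_linear : linear g.
  by move=> k x y; rewrite !gE to_chart_linear G_linear linearP.
have g_symp x y : Omega (g x) (g y) = Omega x y.
  have := invariant_symplectic cf_symp G_C2 G_inv 0 (to_chart x) (to_chart y).
  rewrite /= /chart_form !to_chartK.
  by rewrite -(congr1 (@^~ _) GE) -(congr1 (@^~ _) GE) -!gE.
split=> //.
have [|h gK hK] := linear_inj_surj g_linear; last by exists h.
move=> x y xy; apply: (symplectic_inj Omega_symp) => v.
by rewrite -g_symp xy g_symp.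
Qed.

(** The Liouville part is preserved by every linear symplectic map, so only the
    exact part of theta^a gives a condition. *)
Lemma pullback_theta_Sp (g : V -> V) : Sp Omega g ->
  pullback g (theta_ Omega a) = theta_ Omega a <->
  forall z v, Omega a (g z) * Omega a (g v) = Omega a z * Omega a v.
Proof.
move=> [g_linear _ g_symp].
have E z v : pullback g (theta_ Omega a) z v =
    2^-1 * (Omega z v + Omega a (g z) * Omega a (g v)).
  rewrite /pullback theta_shear tangent_map_linear// /shear.
  by rewrite (biscalarDl Omega) (biscalarZl Omega) g_symp.
have E0 z v : theta_ Omega a z v = 2^-1 * (Omega z v + Omega a z * Omega a v).
  by rewrite theta_shear /shear (biscalarDl Omega) (biscalarZl Omega).
split=> [gt z v|gt]; last first.
  by apply/funext => z; apply/funext => v; rewrite E gt E0.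
have := congr1 (fun alpha => alpha z v) gt; rewrite E E0.
by move/(mulfI half_neq0)/addrI.
Qed.

(** With h the inverse of g, the condition says that the functionals w(h a, .)
    and w(a, .) have the same products. Equality up to sign at one vector z0
    with w(a, z0) <> 0 then decides the sign everywhere. *)
Lemma Sp_fix_up_to_sign (g : V -> V) : Sp Omega g ->
  (forall z v, Omega a (g z) * Omega a (g v) = Omega a z * Omega a v) <->
  (g a = a \/ g a = - a).
Proof.
move=> [g_linear [h gK hK] g_symp].
pose gl : {linear V -> V} :=
  HB.pack g (GRing.isLinear.Build _ _ _ _ g g_linear).
have gN x : g (- x) = - g x by exact: (linearN gl).
split=> [ga|[ga|ga] z v]; last 2 first.
- by rewrite -ga !g_symp ga.
- have gE x : Omega a (g x) = - Omega a x.
    by rewrite -[a in LHS]opprK -ga linearNl g_symp.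
  by rewrite !gE mulrNN.
have haE z : Omega (h a) z = Omega a (g z) by rewrite -[in RHS](hK a) g_symp.
have [a0|/existsNP[z0 /eqP az0]] := pselect (forall z, Omega a z = 0).
  left; have -> : a = 0 by apply: Omega_symp.2.
  exact: (linear0 gl).
have : Omega (h a) z0 ^+ 2 == Omega a z0 ^+ 2 by rewrite haE !expr2 ga.
rewrite eqf_sqr => /orP[]/eqP ha0.
  left; suff ha : h a = a by rewrite -[in LHS]ha hK.
  apply: (symplectic_inj Omega_symp) => v; apply: (mulfI az0).
  by rewrite -[X in X * _]ha0 !haE ga.
right; suff haN : h a = - a by rewrite -[in RHS](hK a) haN gN opprK.
apply: (symplectic_inj Omega_symp) => v; rewrite linearNl.
by apply: (mulfI az0); rewrite mulrN -ga -!haE ha0 mulNr opprK.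
Qed.

End Automorphisms.

Theorem theorem2p1 (R : realType) (V : vectType R) (Omega : {biscalar V})
    (Omega_symplectic : symplectic_form Omega) (a : V) :
  Aut (theta_ Omega a) = [set g : V -> V | Sp Omega g /\ (g a = a \/ g a = - a)].
Proof.
apply/seteqP; split=> g /=.
  move=> gA; have gS := Aut_theta_Sp Omega_symplectic gA; split=> //.
  apply/(Sp_fix_up_to_sign a Omega_symplectic gS).
  by apply/(pullback_theta_Sp a gS); case: gA.
move=> [gS ga]; split; last first.
  apply/(pullback_theta_Sp a gS).
  exact/(Sp_fix_up_to_sign a Omega_symplectic gS).
case: gS => [g_linear [h gK hK] _].
have h_linear : linear h.
  by move=> k x y; apply: (can_inj gK); rewrite g_linear !hK.
split; first exact: smooth_linear.
by exists h; split=> //; exact: smooth_linear.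
Qed.
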